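(* Let $L,M,N$ be positive integers and let $g:=\{g_l\}_{l\in\mathbb{N}_L}\subset\ell^2(\mathbb{Z}\times\mathbb{Z},\mathbb{R})$. Then the following statements are equivalent: 1. $\mathcal{G}(g,L,M,N)$ is a Parseval Gabor frame for $\ell^2(\mathbb{Z}\times\mathbb{Z},\mathbb{H})$. 2. For all $k\in\mathbb{N}_N^2$ and $p\in\mathbb{Z}^2$, $$\left(\sum_{l\in\mathbb{N}_L}\mathcal{M}_{g_l}(k)\mathcal{M}_{g_l}^t(k)\right)_{0_{\mathbb{Z}^2},p}=\frac{1}{M^2}\chi_{\{0_{\mathbb{Z}^2}\}}(p).$$
   Context: $\mathbb{H}$ is the algebra of real quaternions with imaginary units $i,j,ij$. For a positive integer $K$, $\mathbb{N}_K:=\{0,1,\dots,K-1\}$. $\ell^2(\mathbb{Z}\times\mathbb{Z},\mathbb{H})$ is the right quaternionic Hilbert space of functions $f:\mathbb{Z}^2\to\mathbb{H}$ with $\sum_{k\in\mathbb{Z}^2}|f(k)|^2<\infty$, with inner product $\langle f,g\rangle=\sum_{k\in\mathbb{Z}^2}\overline{f(k)}\,g(k)$; $\ell^2(\mathbb{Z}\times\mathbb{Z},\mathbb{R})$ is the subset of real-valued ones. For $n\in\mathbb{Z}^2$, $(T_{nN}f)(k)=f(k-nN)$ where $nN=(n_1N,n_2N)$. For $m=(m_1,m_2)\in\mathbb{N}_M^2$, $(E_{\frac mM}f)(k)=e^{2\pi i\frac{m_1}{M}k_1}f(k)e^{2\pi j\frac{m_2}{M}k_2}$, $k=(k_1,k_2)\in\mathbb{Z}^2$.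 The Gabor system is $\mathcal{G}(g,L,M,N):=\{E_{\frac mM}T_{nN}g_l\}_{l\in\mathbb{N}_L,\,m\in\mathbb{N}_M^2,\,n\in\mathbb{Z}^2}$. It is a Parseval frame if for all $h\in\ell^2(\mathbb{Z}\times\mathbb{Z},\mathbb{H})$: $\sum_{l\in\mathbb{N}_L}\sum_{n\in\mathbb{Z}^2}\sum_{m\in\mathbb{N}_M^2}|\langle E_{\frac mM}T_{nN}g_l,h\rangle|^2=\|h\|^2$. For $h\in\ell^2(\mathbb{Z}\times\mathbb{Z},\mathbb{H})$ and $k\in\mathbb{Z}^2$, $\mathcal{M}_h(k)$ is the matrix indexed by $\mathbb{Z}^2\times\mathbb{Z}^2$ with entries $(\mathcal{M}_h(k))_{p,n}=h(k+pM-nN)$, $p,n\in\mathbb{Z}^2$; $^t$ denotes transpose, so $(\mathcal{M}_{g_l}(k)\mathcal{M}_{g_l}^t(k))_{0_{\mathbb{Z}^2},p}=\sum_{n\in\mathbb{Z}^2}g_l(k-nN)g_l(k+pM-nN)$. $0_{\mathbb{Z}^2}=(0,0)$ and $\chi_E$ is the indicator function of $E$. *)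

(* Defs.v *)
From HB Require Import structures.
From mathcomp Require Import all_boot all_order all_algebra.
From mathcomp Require Import all_classical all_reals all_analysis.
From mathcomp Require Import ring.

Set Implicit Arguments.
Unset Strict Implicit.
Unset Printing Implicit Defensive.

Import Order.TTheory GRing.Theory Num.Theory.
Import numFieldNormedType.Exports.

Local Open Scope classical_set_scope.
Local Open Scope ring_scope.

(* Quat a b c d is the quaternion a + b i + c j + d ij. *)
Record quat (R : Type) := Quat { qre : R; qim1 : R; qim2 : R; qim3 : R }.

Definition quat_code (R : Type) (x : quat R) : R * R * R * R :=
  (qre x, qim1 x, qim2 x, qim3 x).
Definition quat_decode (R : Type) (t : R * R * R * R) : quat R :=
  let: (a, b, c, d) := t in Quat a b c d.
Lemma quat_codeK (R : Type) : cancel (@quat_code R) (@quat_decode R).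
Proof. by case. Qed.

HB.instance Definition _ (R : eqType) :=
  Equality.copy (quat R) (can_type (@quat_codeK R)).
HB.instance Definition _ (R : choiceType) :=
  Choice.copy (quat R) (can_type (@quat_codeK R)).

Section QuaternionRing.
Variable R : comNzRingType.
Implicit Types x y z : quat R.

Definition qzero : quat R := Quat 0 0 0 0.
Definition qone : quat R := Quat 1 0 0 0.
Definition qopp x : quat R := Quat (- qre x) (- qim1 x) (- qim2 x) (- qim3 x).
Definition qadd x y : quat R :=
  Quat (qre x + qre y) (qim1 x + qim1 y) (qim2 x + qim2 y) (qim3 x + qim3 y).
Definition qmul x y : quat R :=
  let: Quat a b c d := x in let: Quat a' b' c' d' := y in
  Quat (a * a' - b * b' - c * c' - d * d')
       (a * b' + b * a' + c * d' - d * c')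
       (a * c' - b * d' + c * a' + d * b')
       (a * d' + b * c' - c * b' + d * a').

Lemma qaddA : associative qadd.
Proof. by case=> ? ? ? ? [? ? ? ?] [? ? ? ?]; congr Quat; rewrite /= addrA. Qed.
Lemma qaddC : commutative qadd.
Proof. by case=> ? ? ? ? [? ? ? ?]; congr Quat; rewrite /= addrC. Qed.
Lemma qadd0 : left_id qzero qadd.
Proof. by case=> ? ? ? ?; congr Quat; rewrite /= add0r. Qed.
Lemma qaddN : left_inverse qzero qopp qadd.
Proof. by case=> ? ? ? ?; congr Quat; rewrite /= addNr. Qed.

HB.instance Definition _ :=
  GRing.isZmodule.Build (quat R) qaddA qaddC qadd0 qaddN.

Lemma qmulA : associative qmul.
Proof. by case=> ? ? ? ? [? ? ? ?] [? ? ? ?]; congr Quat; ring. Qed.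
Lemma qmul1 : left_id qone qmul.
Proof. by case=> ? ? ? ?; congr Quat; ring. Qed.
Lemma qmulr1 : right_id qone qmul.
Proof. by case=> ? ? ? ?; congr Quat; ring. Qed.
Lemma qmulDl : left_distributive qmul +%R.
Proof. by case=> ? ? ? ? [? ? ? ?] [? ? ? ?]; congr Quat => /=; ring. Qed.
Lemma qmulDr : right_distributive qmul +%R.
Proof. by case=> ? ? ? ? [? ? ? ?] [? ? ? ?]; congr Quat => /=; ring. Qed.
Lemma qone_neq0 : qone != 0.
Proof. by apply/eqP => -[] /eqP; rewrite oner_eq0. Qed.

HB.instance Definition _ := GRing.Zmodule_isNzRing.Build (quat R)
  qmulA qmul1 qmulr1 qmulDl qmulDr qone_neq0.

Definition qreal (r : R) : quat R := Quat r 0 0 0.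
Definition qi : quat R := Quat 0 1 0 0.
Definition qj : quat R := Quat 0 0 1 0.
Definition qconj x : quat R := Quat (qre x) (- qim1 x) (- qim2 x) (- qim3 x).

Lemma qi_sqr : qi * qi = -1.
Proof. by rewrite -[-1]/(qopp qone); congr Quat => /=; ring. Qed.
Lemma qj_sqr : qj * qj = -1.
Proof. by rewrite -[-1]/(qopp qone); congr Quat => /=; ring. Qed.
Lemma qi_qj : qi * qj = Quat 0 0 0 1.
Proof. by congr Quat; ring. Qed.
Lemma qj_qi : qj * qi = - (qi * qj).
Proof. by rewrite -[- _]/(qopp (qmul qi qj)); congr Quat => /=; ring. Qed.

End QuaternionRing.

Arguments qi {R}.
Arguments qj {R}.

Notation Z2 := (int * int)%type.

Section Gabor.
Variable R : realType.
Implicit Types (f h : Z2 -> quat R) (A B : Z2 -> Z2 -> quat R).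

Definition qabs (x : quat R) : R :=
  Num.sqrt (qre x ^+ 2 + qim1 x ^+ 2 + qim2 x ^+ 2 + qim3 x ^+ 2).

Lemma qconj_mul (x : quat R) : qconj x * x = qreal (qabs x ^+ 2).
Proof.
rewrite /qabs sqr_sqrtr; last by rewrite !addr_ge0 ?sqr_ge0.
by case: x => a b c d; congr Quat => /=; ring.
Qed.

(* exp (u t) for an imaginary unit u, by Euler's formula. *)
Definition qexp (u : quat R) (t : R) : quat R :=
  qreal (cos t) + u * qreal (sin t).

(* Sums over an arbitrary index set are unconditional: the sum of the positive
   parts minus the sum of the negative parts. This is the usual sum of an
   absolutely summable family; off that case the value is meaningless. *)
Definition rsum (I : choiceType) (a : I -> R) : R :=
  fine (\esum_(i in [set: I]) (Num.max (a i) 0)%:E)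
  - fine (\esum_(i in [set: I]) (Num.max (- a i) 0)%:E).

Definition qsum (I : choiceType) (a : I -> quat R) : quat R :=
  Quat (rsum (fun i => qre (a i))) (rsum (fun i => qim1 (a i)))
       (rsum (fun i => qim2 (a i))) (rsum (fun i => qim3 (a i))).

Definition l2normsq h : \bar R := \esum_(k in [set: Z2]) (qabs (h k) ^+ 2)%:E.

Definition l2 h : Prop := (l2normsq h < +oo)%E.

Definition l2real h : Prop := l2 h /\ forall k, exists r : R, h k = qreal r.

Definition l2inner f h : quat R := qsum (fun k => qconj (f k) * h k).

Definition translation (N : nat) (n : Z2) f : Z2 -> quat R :=
  fun k => f (k - n *+ N).

Definition modulation (M : nat) (m : 'I_M * 'I_M) f : Z2 -> quat R :=
  fun k => qexp qi (2 * pi * (m.1%:R / M%:R) * k.1%:~R) * f k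
           * qexp qj (2 * pi * (m.2%:R / M%:R) * k.2%:~R).

Definition gabor_system (L M N : nat) (g : 'I_L -> Z2 -> quat R)
    (l : 'I_L) (m : 'I_M * 'I_M) (n : Z2) : Z2 -> quat R :=
  modulation m (translation N n (g l)).

(* The equality is in \bar R, so it includes convergence of the left side. *)
Definition parseval_gabor_frame (L M N : nat) (g : 'I_L -> Z2 -> quat R) : Prop :=
  forall h, l2 h ->
    (\sum_(l < L) \esum_(n in [set: Z2]) \sum_(m : 'I_M * 'I_M)
      (qabs (l2inner (gabor_system N g l m n) h) ^+ 2)%:E)%E = l2normsq h.

Definition imx_mul A B : Z2 -> Z2 -> quat R :=
  fun p q => qsum (fun n => A p n * B n q).

Definition imx_tr A : Z2 -> Z2 -> quat R := fun p q => A q p.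

Definition gabor_mx (M N : nat) h (k : Z2) : Z2 -> Z2 -> quat R :=
  fun p n => h (k + p *+ M - n *+ N).

End Gabor.

(* Main.v *)
Require Import Defs.
From mathcomp Require Import all_boot all_order all_algebra.
From mathcomp Require Import all_classical all_reals all_analysis.
From mathcomp Require Import ring lra.

(* Since the [g_l] are real, summing over the modulations is a Plancherel
   identity on residues mod [M]: the inner sums over [m_2], then [m_1], of the
   exponentials are real, hence central, which defeats noncommutativity. For a
   finitely supported [h] the frame sum is therefore
   [M^2 \sum_(k = k' mod M) <h k, h k'> G k k'], where
   [G k k' = \sum_l \sum_n g_l (k - n N) g_l (k' - n N)]. Testing on
   [delta_k] and [delta_k + delta_k'] shows that being Parseval forces
   [G k k' = [k = k'] / M^2] whenever [k = k' mod M]; since [G] is invariant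
   under simultaneous shifts by [N Z^2], this is condition 2. Conversely this
   value of [G] gives the Parseval identity on finitely supported functions,
   which extends to all of [l2] by density. *)

Set Implicit Arguments.
Unset Strict Implicit.
Unset Printing Implicit Defensive.

Import Order.TTheory GRing.Theory Num.Theory.
Local Open Scope classical_set_scope.
Local Open Scope ring_scope.

(** * Unconditional sums of real families *)

Section RealSums.
Variables (R : realType) (I : choiceType).
Implicit Types (a b u v : I -> R) (s : seq I).

Definition rsummable a : Prop := (\esum_(i in [set: I]) `|a i|%:E < +oo)%E.

Lemma rsummable_le a b :
  (forall i, `|a i| <= b i) -> rsummable b -> rsummable a.
Proof.
move=> ab; apply: le_lt_trans; apply: le_esum => i _.
by rewrite lee_fin (le_trans (ab i)) ?ler_norm.
Qed.

Lemma rsummableD a b :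
  rsummable a -> rsummable b -> rsummable (fun i => a i + b i).
Proof.
move=> sa sb; apply: le_lt_trans (lte_add_pinfty sa sb).
rewrite -esumD => [|i _|i _]; rewrite ?lee_fin //.
by apply: le_esum => i _; rewrite lee_fin ler_normD.
Qed.

(** One inequality holds for every nonnegative scalar and family; applied to [c^-1] and the family
    [c * u], it gives the reverse one. *)
Lemma esumZ (c : R) u : 0 <= c -> (forall i, 0 <= u i) ->
  (\esum_(i in [set: I]) (c * u i)%:E = c%:E * \esum_(i in [set: I]) (u i)%:E)%E.
Proof.
move=> c0 u0; have le (d : R) (w : I -> R) : 0 <= d -> (forall i, 0 <= w i) ->
  (\esum_(i in [set: I]) (d * w i)%:E <= d%:E * \esum_(i in [set: I]) (w i)%:E)%E.
  move=> d0 w0; apply: ge_ereal_sup => _ [A [finA _] <-].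
  have -> : (\sum_(i \in A) (d * w i)%:E = d%:E * \sum_(i \in A) (w i)%:E)%E.
    by rewrite ge0_mule_fsumr // => i; rewrite lee_fin.
  apply: lee_wpmul2l; rewrite ?lee_fin //; apply: esum_ge; exists A => //; split.
apply/eqP; rewrite eq_le le //=.
rewrite le_eqVlt in c0; case/orP: c0 => [/eqP <-|c0].
  by rewrite mul0e esum_ge0 // => i _; rewrite mul0r.
have ci : 0 <= c^-1 by rewrite invr_ge0 ltW.
have := le c^-1 (fun i => c * u i) ci (fun i => mulr_ge0 (ltW c0) (u0 i)).
rewrite (eq_esum (b := fun i => (u i)%:E)); last first.
  by move=> i _; rewrite mulKf // gt_eqF.
move=> /(lee_wpmul2l (x := c%:E)) /=; rewrite lee_fin (ltW c0) => /(_ isT).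
by rewrite muleA -EFinM mulfV ?gt_eqF // mul1e.
Qed.

Lemma rsummableZ (c : R) a : rsummable a -> rsummable (fun i => c * a i).
Proof.
move=> sa; rewrite /rsummable (eq_esum (b := fun i => (`|c| * `|a i|)%:E)).
  by rewrite esumZ // lte_mul_pinfty.
by move=> i _; rewrite normrM.
Qed.

Lemma rsummable_fin u : rsummable u -> (forall i, 0 <= u i) ->
  ((\esum_(i in [set: I]) (u i)%:E)%E \is a fin_num).
Proof.
move=> su u0; rewrite ge0_fin_numE; last by apply: esum_ge0 => i _; rewrite lee_fin.
apply: le_lt_trans su; apply: le_esum => i _; by rewrite lee_fin ler_norm.
Qed.

(** Any splitting into nonnegative summable parts computes [rsum], not only the canonical one. This
    is what makes linearity provable: the positive part of a sum is not the sum of the positive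
    parts. *)
Lemma rsum_sub u v : rsummable u -> rsummable v ->
  (forall i, 0 <= u i) -> (forall i, 0 <= v i) ->
  rsum (fun i => u i - v i) = fine (\esum_(i in [set: I]) (u i)%:E)
                            - fine (\esum_(i in [set: I]) (v i)%:E).
Proof.
move=> su sv u0 v0; rewrite /rsum.
set P := (\esum_(i in _) (Num.max (u i - v i) 0)%:E)%E.
set Q := (\esum_(i in _) (Num.max (- (u i - v i)) 0)%:E)%E.
set U := (\esum_(i in _) (u i)%:E)%E; set V := (\esum_(i in _) (v i)%:E)%E.
have Uf : U \is a fin_num by apply: rsummable_fin.
have Vf : V \is a fin_num by apply: rsummable_fin.
have Pf : P \is a fin_num.
  apply: rsummable_fin => [|i]; last by rewrite le_max lexx orbT.
  apply: (rsummable_le (b := u)) => // i.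
  by rewrite ger0_norm ?le_max ?lexx ?orbT // ge_max u0 lerBlDr lerDl v0.
have Qf : Q \is a fin_num.
  apply: rsummable_fin => [|i]; last by rewrite le_max lexx orbT.
  apply: (rsummable_le (b := v)) => // i.
  by rewrite ger0_norm ?le_max ?lexx ?orbT // ge_max v0 opprB lerBlDr lerDl u0.
(* Pointwise, [max (u - v) 0 + v = max (v - u) 0 + u]; adding instead of subtracting keeps all terms
   nonnegative. *)
have E : (P + V = Q + U)%E.
  rewrite -!esumD => [|i _|i _|i _|i _];
    rewrite ?lee_fin ?le_max ?lexx ?orbT //.
  apply: eq_esum => i _; congr (_%:E).
  by rewrite /Num.max; case: ifP; case: ifP; move: (u0 i) (v0 i); lra.
have := congr1 fine E; rewrite !fineD //; lra.
Qed.

Lemma rsum_ge0 u : rsummable u -> (forall i, 0 <= u i) ->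
  (\esum_(i in [set: I]) (u i)%:E = (rsum u)%:E)%E.
Proof.
move=> su u0; have -> : rsum u = rsum (fun i => u i - 0).
  by congr rsum; apply/funext => i; rewrite subr0.
rewrite (rsum_sub (u := u) (v := fun _ => 0)) //.
  by rewrite [X in _ - fine X]esum1 //= subr0 fineK // rsummable_fin.
by rewrite /rsummable esum1 // => i _; rewrite normr0.
Qed.

Let pos a i := Num.max (a i) 0.
Let neg a i := Num.max (- a i) 0.
Let pos_ge0 a i : 0 <= pos a i. Proof. by rewrite le_max lexx orbT. Qed.
Let neg_ge0 a i : 0 <= neg a i. Proof. by rewrite le_max lexx orbT. Qed.
Let pos_neg a i : pos a i - neg a i = a i.
Proof. by rewrite /pos /neg /Num.max; do 2 case: ifP; lra. Qed.
Let norm_pos_neg a i : pos a i + neg a i = `|a i|.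
Proof.
rewrite /pos /neg /Num.max; case: (ger0P (a i)) => ?; do ?case: ifP; lra.
Qed.
Let rsummable_pos a : rsummable a -> rsummable (pos a).
Proof.
apply: le_lt_trans; apply: le_esum => i _.
by rewrite lee_fin -(norm_pos_neg a) ger0_norm ?pos_ge0 // lerDl neg_ge0.
Qed.
Let rsummable_neg a : rsummable a -> rsummable (neg a).
Proof.
apply: le_lt_trans; apply: le_esum => i _.
by rewrite lee_fin -(norm_pos_neg a) ger0_norm ?neg_ge0 // lerDr pos_ge0.
Qed.

Lemma rsumD a b : rsummable a -> rsummable b ->
  rsum (fun i => a i + b i) = rsum a + rsum b.
Proof.
move=> sa sb.
have -> : rsum (fun i => a i + b i) =
    rsum (fun i => (pos a i + pos b i) - (neg a i + neg b i)).
  by congr rsum; apply/funext => i; rewrite -(pos_neg a) -(pos_neg b); lra.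
have [pa pb] := (rsummable_pos sa, rsummable_pos sb).
have [na nb] := (rsummable_neg sa, rsummable_neg sb).
rewrite rsum_sub; last 4 first.
- exact: rsummableD.
- exact: rsummableD.
- by move=> i; rewrite addr_ge0 ?pos_ge0.
- by move=> i; rewrite addr_ge0 ?neg_ge0.
under eq_esum do rewrite EFinD.
under [X in _ - fine X]eq_esum do rewrite EFinD.
rewrite !esumD => [|i _|i _|i _|i _]; rewrite ?lee_fin ?pos_ge0 ?neg_ge0 //.
rewrite !fineD ?rsummable_fin //.
rewrite /rsum -/(pos a) -/(neg a) -/(pos b) -/(neg b); lra.
Qed.

Lemma rsumN a : rsum (fun i => - a i) = - rsum a.
Proof.
rewrite /rsum opprB; congr (_ - fine _).
by apply: eq_esum => i _; rewrite opprK.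
Qed.

Lemma rsumZ (c : R) a : rsummable a -> rsum (fun i => c * a i) = c * rsum a.
Proof.
move=> sa; wlog c0 : c / 0 <= c => [H|].
  have [/H //|/ltW c0] := leP 0 c.
  rewrite -[c]opprK mulNr -H ?oppr_ge0 // -rsumN.
  by congr rsum; apply/funext => i; rewrite mulNr.
have -> : rsum (fun i => c * a i) = rsum (fun i => c * pos a i - c * neg a i).
  by congr rsum; apply/funext => i; rewrite -mulrBr pos_neg.
have [pa na] := (rsummable_pos sa, rsummable_neg sa).
rewrite rsum_sub; last 4 first.
- exact: rsummableZ.
- exact: rsummableZ.
- by move=> i; rewrite mulr_ge0 ?pos_ge0.
- by move=> i; rewrite mulr_ge0 ?neg_ge0.
rewrite !esumZ ?fineM ?rsummable_fin // -mulrBr //.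
Qed.

Lemma rsummable_sum (J : Type) (t : seq J) (F : J -> I -> R) :
  (forall j, rsummable (F j)) -> rsummable (fun i => \sum_(j <- t) F j i).
Proof.
move=> sF; elim: t => [|j t IH].
  by rewrite /rsummable esum1 // => i _; rewrite big_nil normr0.
by under eq_fun do rewrite big_cons; exact: rsummableD.
Qed.

Lemma rsum_sum (J : Type) (t : seq J) (F : J -> I -> R) :
  (forall j, rsummable (F j)) ->
  rsum (fun i => \sum_(j <- t) F j i) = \sum_(j <- t) rsum (F j).
Proof.
move=> sF; elim: t => [|j t IH].
  rewrite big_nil; under eq_fun do rewrite big_nil.
  by rewrite /rsum !esum1 ?subrr // => i _; rewrite ?oppr0 maxxx.
rewrite big_cons -IH -rsumD //; last exact: rsummable_sum.
by congr rsum; apply/funext => i; rewrite big_cons.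
Qed.

(** The sums of the positive and negative parts are nonnegative and add up to the sum of [|a|], so
    their difference is bounded by [rsum b] in absolute value. *)
Lemma ler_norm_rsum a b : (forall i, `|a i| <= b i) -> rsummable b ->
  `|rsum a| <= rsum b.
Proof.
move=> ab sb; have b0 i : 0 <= b i by apply: le_trans (ab i).
have sa : rsummable a by exact: rsummable_le ab sb.
have [pa na] := (rsummable_pos sa, rsummable_neg sa).
have Epa := rsummable_fin pa (pos_ge0 a); have Ena := rsummable_fin na (neg_ge0 a).
have P0 : 0 <= fine (\esum_(i in [set: I]) (pos a i)%:E)%E.
  by apply/fine_ge0/esum_ge0 => i _; rewrite lee_fin.
have N0 : 0 <= fine (\esum_(i in [set: I]) (neg a i)%:E)%E.
  by apply/fine_ge0/esum_ge0 => i _; rewrite lee_fin.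
have : fine (\esum_(i in [set: I]) (pos a i)%:E)%E +
       fine (\esum_(i in [set: I]) (neg a i)%:E)%E <= rsum b.
  rewrite -lee_fin -(rsum_ge0 sb) // EFinD !fineK // -esumD => [|i _|i _];
    rewrite ?lee_fin //.
  by apply: le_esum => i _; rewrite -EFinD lee_fin norm_pos_neg.
by rewrite ler_norml /rsum -/(pos a) -/(neg a) => ?; apply/andP; split; lra.
Qed.

(** * Finitely supported families and tails of summable ones *)

Lemma esum_single (i0 : I) (u : I -> R) : 0 <= u i0 ->
  (\esum_(i in [set: I]) (if i == i0 then u i else 0)%:E = (u i0)%:E)%E.
Proof.
move=> u0; rewrite -(esum_set1 (a := fun i => (u i)%:E)) ?lee_fin //.
rewrite [RHS]esum_mkcond; apply: eq_esum => i _.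
by case: eqP => [->|ni]; [rewrite mem_set | rewrite memNset].
Qed.

Lemma rsummable_single i0 a : rsummable (fun i => if i == i0 then a i else 0).
Proof.
rewrite /rsummable (eq_esum (b := fun i => (if i == i0 then `|a i| else 0)%:E)).
  by rewrite (esum_single (i0 := i0) (u := fun i => `|a i|)) // ltry.
by move=> i _; case: ifP; rewrite ?normr0.
Qed.

Lemma rsum_single i0 a : rsum (fun i => if i == i0 then a i else 0) = a i0.
Proof.
rewrite -(pos_neg a i0) /rsum; congr (_ - _).
  rewrite -[RHS]/(fine (pos a i0)%:E) -(esum_single (u := pos a)) ?pos_ge0 //.
  by congr fine; apply: eq_esum => i _; case: ifP; rewrite ?maxxx.
rewrite -[RHS]/(fine (neg a i0)%:E) -(esum_single (u := neg a)) ?neg_ge0 //.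
by congr fine; apply: eq_esum => i _; case: ifP; rewrite ?oppr0 ?maxxx.
Qed.

Lemma finsuppE s a : uniq s -> (forall i, i \notin s -> a i = 0) ->
  a = (fun i => \sum_(j <- s) if i == j then a i else 0).
Proof.
move=> us sa; apply/funext => i; have [si|nsi] := boolP (i \in s).
  rewrite (bigD1_seq i) //= eqxx big1 ?addr0 // => j.
  by rewrite eq_sym => /negbTE ->.
rewrite sa // big_seq big1 // => j js; case: eqP => //.
Qed.

Lemma rsummable_finsupp s a : uniq s -> (forall i, i \notin s -> a i = 0) ->
  rsummable a.
Proof.
move=> us sa; rewrite (finsuppE us sa).
by apply: rsummable_sum => j; exact: rsummable_single.
Qed.

Lemma rsum_finsupp s a : uniq s -> (forall i, i \notin s -> a i = 0) ->
  rsum a = \sum_(i <- s) a i.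
Proof.
move=> us sa; rewrite {1}(finsuppE us sa) rsum_sum; last first.
  by move=> j; exact: rsummable_single.
by apply: eq_bigr => j _; exact: rsum_single.
Qed.

(** The sum is a supremum of finite partial sums; [s] enumerates a finite set whose partial sum is
    within [e] of it. *)
Lemma esum_tail u (e : R) : rsummable u -> (forall i, 0 <= u i) -> 0 < e ->
  exists2 s, uniq s &
    (\esum_(i in [set: I]) (if i \in s then 0 else u i)%:E <= e%:E)%E.
Proof.
move=> su u0 e0; have fu := rsummable_fin su u0.
have [_ [A [finA _] <-] lt] := ub_ereal_sup_adherent e0 fu.
exists (finmap.enum_fset (fset_set A)); first exact: finmap.fset_uniq.
move: lt; rewrite -/(\esum_(i in [set: I]) (u i)%:E)%E fsbig_finite //=.
set s := finmap.enum_fset _.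
have us : uniq s by exact: finmap.fset_uniq.
have head i : i \notin s -> (if i \in s then u i else 0) = 0 by move=> /negbTE ->.
have <- : (\esum_(i in [set: I]) (if i \in s then u i else 0)%:E =
   \sum_(i <- s) (u i)%:E)%E.
  rewrite (rsum_ge0 (rsummable_finsupp us head)) => [|i]; last by case: ifP.
  rewrite (rsum_finsupp us head) -sumEFin big_seq [RHS]big_seq.
  by apply: eq_bigr => i ->.
have h0 i : 0 <= (if i \in s then u i else 0) by case: ifP.
have t0 i : 0 <= (if i \in s then 0 else u i) by case: ifP.
have sh : rsummable (fun i => if i \in s then u i else 0).
  exact: rsummable_finsupp us head.
have st : rsummable (fun i => if i \in s then 0 else u i).
  by apply: (rsummable_le (b := u)) => // i; rewrite ger0_norm //; case: ifP.
have -> : (\esum_(i in [set: I]) (u i)%:E =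
  \esum_(i in [set: I]) (if i \in s then u i else 0)%:E +
  \esum_(i in [set: I]) (if i \in s then 0 else u i)%:E)%E.
  rewrite -esumD => [|i _|i _]; rewrite ?lee_fin //.
  by apply: eq_esum => i _; rewrite -EFinD; case: ifP; rewrite ?addr0 ?add0r.
rewrite (rsum_ge0 sh) // (rsum_ge0 st) // -!EFinD lte_fin lee_fin; lra.
Qed.

End RealSums.

Lemma rsum_reindex (R : realType) (I J : choiceType) (f : I -> J) (a : J -> R) :
  bijective f -> rsum a = rsum (fun i => a (f i)).
Proof.
move=> bf; have sb : set_bij [set: I] [set: J] f by rewrite setTT_bijective.
by rewrite /rsum !(reindex_esum [set: I] [set: J] f).
Qed.

Lemma rsummable_inj (R : realType) (I J : choiceType) (f : I -> J) (a : J -> R) :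
  injective f -> rsummable a -> rsummable (fun i => a (f i)).
Proof.
move=> injf; apply: le_lt_trans.
rewrite -(esum_image [set: I] f (fun j => `|a j|%:E)); last by move=> x y _ _ /injf.
rewrite esum_mkcond; apply: le_esum => i _; case: ifP => _; rewrite ?lee_fin //.
Qed.

(** * Quaternion exponentials and character sums *)

Section Quaternions.
Variable R : realType.
Implicit Types (x y z : quat R) (r t : R).

(** The Euclidean inner product on the four real coordinates. Working with it keeps norm estimates
    commutative. *)
Definition qdot x y : R :=
  qre x * qre y + qim1 x * qim1 y + qim2 x * qim2 y + qim3 x * qim3 y.

Lemma qabs_sqr x : qabs x ^+ 2 = qdot x x.
Proof. by rewrite /qabs sqr_sqrtr ?addr_ge0 ?sqr_ge0 // /qdot !expr2. Qed.

Lemma qdot_ge0 x : 0 <= qdot x x.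
Proof. by rewrite -qabs_sqr sqr_ge0. Qed.

Lemma qdotE x y : qdot x y = qre (qconj x * y).
Proof. by case: x y => a b c d [? ? ? ?]; rewrite /qdot /=; ring. Qed.

Lemma qdot_realM r t x y :
  qdot (qreal r * x) (qreal t * y) = r * t * qdot x y.
Proof. by case: x y => a b c d [? ? ? ?]; rewrite /qdot /=; ring. Qed.

Lemma qreD x y : qre (x + y) = qre x + qre y. Proof. by []. Qed.
Lemma qim1D x y : qim1 (x + y) = qim1 x + qim1 y. Proof. by []. Qed.
Lemma qim2D x y : qim2 (x + y) = qim2 x + qim2 y. Proof. by []. Qed.
Lemma qim3D x y : qim3 (x + y) = qim3 x + qim3 y. Proof. by []. Qed.

Lemma qre_sum (J : Type) (s : seq J) (P : pred J) (F : J -> quat R) :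
  qre (\sum_(j <- s | P j) F j) = \sum_(j <- s | P j) qre (F j).
Proof. exact: (big_morph _ qreD erefl). Qed.
Lemma qim1_sum (J : Type) (s : seq J) (P : pred J) (F : J -> quat R) :
  qim1 (\sum_(j <- s | P j) F j) = \sum_(j <- s | P j) qim1 (F j).
Proof. exact: (big_morph _ qim1D erefl). Qed.
Lemma qim2_sum (J : Type) (s : seq J) (P : pred J) (F : J -> quat R) :
  qim2 (\sum_(j <- s | P j) F j) = \sum_(j <- s | P j) qim2 (F j).
Proof. exact: (big_morph _ qim2D erefl). Qed.
Lemma qim3_sum (J : Type) (s : seq J) (P : pred J) (F : J -> quat R) :
  qim3 (\sum_(j <- s | P j) F j) = \sum_(j <- s | P j) qim3 (F j).
Proof. exact: (big_morph _ qim3D erefl). Qed.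

Lemma quat_eq x y : qre x = qre y -> qim1 x = qim1 y -> qim2 x = qim2 y ->
  qim3 x = qim3 y -> x = y.
Proof. by case: x y => ? ? ? ? [? ? ? ?] /= -> -> -> ->. Qed.

Lemma qrealD r t : qreal (r + t) = qreal r + qreal t.
Proof. by apply: quat_eq; rewrite /= ?addr0. Qed.

Lemma qrealM r t : qreal (r * t) = qreal r * qreal t.
Proof. by apply: quat_eq => /=; ring. Qed.

Lemma qreal_sum (J : Type) (s : seq J) (P : pred J) (F : J -> R) :
  qreal (\sum_(j <- s | P j) F j) = \sum_(j <- s | P j) qreal (F j).
Proof. exact: (big_morph _ qrealD erefl). Qed.

Lemma qreal_comm r x : qreal r * x = x * qreal r.
Proof. by case: x => ? ? ? ?; apply: quat_eq => /=; ring. Qed.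

Lemma qre_realM r x : qre (qreal r * x) = r * qre x.
Proof. by case: x => *; rewrite /=; ring. Qed.

Lemma qconjD x y : qconj (x + y) = qconj x + qconj y.
Proof. by apply: quat_eq; rewrite //= opprD. Qed.

Lemma qconjM x y : qconj (x * y) = qconj y * qconj x.
Proof. by case: x y => ? ? ? ? [? ? ? ?]; apply: quat_eq => /=; ring. Qed.

Lemma qconjK x : qconj (qconj x) = x.
Proof. by apply: quat_eq; rewrite //= opprK. Qed.

Lemma qconj_sum (J : Type) (s : seq J) (P : pred J) (F : J -> quat R) :
  qconj (\sum_(j <- s | P j) F j) = \sum_(j <- s | P j) qconj (F j).
Proof. by apply: (big_morph _ qconjD); apply: quat_eq; rewrite //= oppr0. Qed.

Lemma qexp_i t : qexp qi t = Quat (cos t) (sin t) 0 0.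
Proof. by apply: quat_eq => /=; ring. Qed.

Lemma qexp_j t : qexp qj t = Quat (cos t) 0 (sin t) 0.
Proof. by apply: quat_eq => /=; ring. Qed.

Lemma qexp_i_conj r t : qexp qi r * qconj (qexp qi t) = qexp qi (r - t).
Proof.
by rewrite !qexp_i cosD sinD cosN sinN; apply: quat_eq => /=; ring.
Qed.

Lemma qexp_j_conj r t : qexp qj r * qconj (qexp qj t) = qexp qj (r - t).
Proof.
by rewrite !qexp_j cosD sinD cosN sinN; apply: quat_eq => /=; ring.
Qed.

End Quaternions.

(** * Orthogonality of the exponentials modulo [M] *)

Section CharacterSums.
Variable R : realType.
Implicit Types (d z : int) (x : R).

Lemma cos_2piz z : cos (2 * pi * z%:~R) = 1 :> R.
Proof.
have H n : cos (2 * pi * n%:R) = 1 :> R.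
  have -> : 2 * pi * n%:R = 0 + (pi *+ 2) *+ n :> R.
    by rewrite add0r -[RHS]mulr_natr -[pi *+ 2]mulr_natl.
  by rewrite (periodicn (@cosD2pi R)) cos0.
by case: z => n; rewrite ?NegzE ?mulrNz ?mulrN ?cosN; exact: H.
Qed.

Lemma sin_2piz z : sin (2 * pi * z%:~R) = 0 :> R.
Proof. by apply: cos1sin0; rewrite cos_2piz normr1. Qed.

(** Removing multiples of [M] from [d] only changes the sign of the sine and leaves an angle
    strictly between [0] and [pi]. The sine is the factor cancelled in the telescoping argument
    below. *)
Lemma sin_pi_frac_neq0 (M : nat) d : (0 < M)%N -> ~~ (M %| d)%Z ->
  sin (pi * (d%:~R / M%:R)) != 0 :> R.
Proof.
move=> M0 nd; have M0' : M%:R != 0 :> R by rewrite pnatr_eq0 -lt0n.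
have H n : ~~ (M %| n)%N -> sin (pi * (n%:R / M%:R)) != 0 :> R.
  move=> nn; have := divn_eq n M; set q := (n %/ M)%N; set r := (n %% M)%N => ->.
  have r0 : (0 < r)%N by rewrite lt0n.
  have rM : (r < M)%N by rewrite ltn_mod.
  have -> : pi * ((q * M + r)%:R / M%:R) = pi * (r%:R / M%:R) + pi *+ q :> R.
    by rewrite natrD natrM -mulr_natr; field.
  rewrite (alternatingn (@sinDpi R)) mulf_neq0 ?signr_eq0 // gt_eqF //.
  apply: sin_gt0_pi; rewrite mulr_gt0 ?pi_gt0 ?divr_gt0 ?ltr0n //=.
  by rewrite gtr_pMr ?pi_gt0 // ltr_pdivrMr ?ltr0n // mul1r ltr_nat.
case: d nd => n nd; first exact: H.
by rewrite NegzE mulrNz mulNr mulrN sinN oppr_eq0; apply: H.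
Qed.

Lemma sum_cos_sin (M : nat) d : (0 < M)%N ->
  \sum_(m < M) cos (2 * pi * (m%:R / M%:R) * d%:~R) =
    (if (M %| d)%Z then M%:R else 0) :> R /\
  \sum_(m < M) sin (2 * pi * (m%:R / M%:R) * d%:~R) = 0 :> R.
Proof.
move=> M0; have M0' : M%:R != 0 :> R by rewrite pnatr_eq0 -lt0n.
case: ifP => [/dvdzP[q ->]|/negbT nd].
  have E (m : 'I_M) :
      2 * pi * (m%:R / M%:R) * (q * M%:Z)%:~R = 2 * pi * (m%:Z * q)%:~R :> R.
    by rewrite !intrM -!pmulrn; field.
  split; last by apply: big1 => m _; rewrite E sin_2piz.
  under eq_bigr do rewrite E cos_2piz.
  by rewrite sumr_const card_ord.
set x : R := pi * (d%:~R / M%:R).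
have sx : sin x != 0 by exact: sin_pi_frac_neq0.
have ang m : 2 * pi * (m%:R / M%:R) * d%:~R = 2 * m%:R * x.
  by rewrite /x; field.
have xM : 2 * M%:R * x = 2 * pi * d%:~R by rewrite /x; field.
(* The telescoped sums run from the angle [- x] to [(2 * M - 1) * x]; [cM] and [sM] show that both
   ends contribute the same value. *)
have cM : cos ((2 * M%:R - 1) * x) = cos x.
  by rewrite mulrBl mul1r xM cosB cos_2piz sin_2piz; ring.
have sM : sin ((2 * M%:R - 1) * x) = - sin x.
  by rewrite mulrBl mul1r xM sinB cos_2piz sin_2piz; ring.
(* Multiplying by [2 sin x] makes both sums telescope. *)
split; apply: (mulfI (x := 2 * sin x)); rewrite ?mulf_neq0 // ?pnatr_eq0 // mulr0.
  rewrite mulr_sumr; under eq_bigr => m _.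
    rewrite ang (_ : 2 * sin x * _ =
      sin ((2 * m.+1%:R - 1) * x) - sin ((2 * m%:R - 1) * x)); last first.
      rewrite -[m.+1%:R]natr1 (_ : (2 * (m%:R + 1) - 1) * x = 2 * m%:R * x + x); last ring.
      by rewrite mulrBl mul1r sinD sinB; ring.
    over.
  rewrite /= -(big_mkord xpredT (fun m => sin ((2 * m.+1%:R - 1) * x)
    - sin ((2 * m%:R - 1) * x))) telescope_sumr //.
  by rewrite sM mulr0 sub0r mulN1r sinN subrr.
rewrite mulr_sumr; under eq_bigr => m _.
  rewrite ang (_ : 2 * sin x * _ =
    - cos ((2 * m.+1%:R - 1) * x) - - cos ((2 * m%:R - 1) * x)); last first.
    rewrite -[m.+1%:R]natr1 (_ : (2 * (m%:R + 1) - 1) * x = 2 * m%:R * x + x); last ring.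
    by rewrite mulrBl mul1r cosD cosB; ring.
  over.
rewrite /= -(big_mkord xpredT (fun m => - cos ((2 * m.+1%:R - 1) * x)
  - - cos ((2 * m%:R - 1) * x))) telescope_sumr //.
by rewrite cM mulr0 sub0r mulN1r cosN subrr.
Qed.

(** The sine sum vanishes, so the component along [u] disappears and the result is real, hence
    central. *)
Lemma sum_qexp (u : quat R) (M : nat) d : (0 < M)%N ->
  \sum_(m < M) qexp u (2 * pi * (m%:R / M%:R) * d%:~R) =
    qreal (if (M %| d)%Z then M%:R else 0).
Proof.
move=> M0; have [C S] := @sum_cos_sin M d M0.
by rewrite big_split /= -qreal_sum C -mulr_sumr -qreal_sum S mulr0 addr0.
Qed.

(** Modulation multiplies by one exponential on each side; on a real function both merge into this
    left factor. It is not multiplicative in [k] in general, since [qi] and [qj] do not commute. *)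
Definition gabor_char (M : nat) (m : 'I_M * 'I_M) (k : Z2) : quat R :=
  qexp qi (2 * pi * (m.1%:R / M%:R) * k.1%:~R)
  * qexp qj (2 * pi * (m.2%:R / M%:R) * k.2%:~R).

Definition eqmodZ2 (M : nat) (k k' : Z2) : bool :=
  (M %| k.1 - k'.1)%Z && (M %| k.2 - k'.2)%Z.

Lemma sum_gabor_char (M : nat) (k k' : Z2) : (0 < M)%N ->
  \sum_(m : 'I_M * 'I_M) gabor_char m k * qconj (gabor_char m k') =
    qreal (if eqmodZ2 M k k' then M%:R ^+ 2 else 0).
Proof.
move=> M0.
pose A (m : 'I_M) := qexp (@qi R) (2 * pi * (m%:R / M%:R) * k.1%:~R).
pose A' (m : 'I_M) := qexp (@qi R) (2 * pi * (m%:R / M%:R) * k'.1%:~R).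
(* Conjugation reverses products, so the two [qj] exponentials meet in the middle and can be summed
   over [m2] first. The real result then moves out, and the two [qi] exponentials become
   adjacent. *)
transitivity (\sum_(m1 < M) A m1 *
  (\sum_(m2 < M) qexp qj (2 * pi * (m2%:R / M%:R) * (k.2 - k'.2)%:~R)) *
  qconj (A' m1)).
  rewrite -(pair_big xpredT xpredT (fun m1 m2 : 'I_M =>
    gabor_char (m1, m2) k * qconj (gabor_char (m1, m2) k'))) /=.
  apply: eq_bigr => m1 _; rewrite mulr_sumr mulr_suml; apply: eq_bigr => m2 _.
  rewrite /gabor_char qconjM /= -/(A m1) -/(A' m1).
  by rewrite intrB mulrBr -qexp_j_conj !mulrA.
rewrite sum_qexp //; under eq_bigr => m _.
  rewrite -qreal_comm -mulrA qexp_i_conj -mulrBr -intrB.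
  over.
rewrite -mulr_sumr sum_qexp // -qrealM /eqmodZ2 andbC.
by case: ifP; case: ifP => _ _ //=; rewrite ?mulr0 ?mul0r.
Qed.

(** Expanding the square places [gabor_char m k * qconj (gabor_char m k')] between [qconj (y k)] and
    [y k']. Its sum over [m] is real and so can be pulled out from between them. *)
Lemma gabor_char_plancherel (M : nat) (s : seq Z2) (y : Z2 -> quat R) :
  (0 < M)%N ->
  \sum_(m : 'I_M * 'I_M)
    qabs (\sum_(k <- s) qconj (gabor_char m k) * y k) ^+ 2 =
  \sum_(k <- s) \sum_(k' <- s)
    (if eqmodZ2 M k k' then M%:R ^+ 2 else 0) * qdot (y k) (y k').
Proof.
move=> M0; under eq_bigr => m _.
  rewrite qabs_sqr qdotE qconj_sum mulr_suml qre_sum.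
  under eq_bigr => k _ do rewrite mulr_sumr qre_sum.
  over.
rewrite exchange_big; apply: eq_bigr => k _ /=.
rewrite exchange_big; apply: eq_bigr => k' _ /=.
rewrite -qre_sum; under eq_bigr => m _.
  rewrite qconjM qconjK mulrA -(mulrA (qconj (y k))).
  over.
rewrite -mulr_suml -mulr_sumr sum_gabor_char //.
by rewrite -qreal_comm -mulrA qdotE qre_realM.
Qed.

End CharacterSums.

(** * Square-summable functions and density *)

Section SquareSummable.
Variable R : realType.
Implicit Types (x y c : quat R) (f h : Z2 -> quat R) (t e : R).

Lemma qdotC x y : qdot x y = qdot y x.
Proof. by rewrite /qdot; ring. Qed.

Lemma qdotDr x y y' : qdot x (y + y') = qdot x y + qdot x y'.
Proof. by rewrite /qdot /=; ring. Qed.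

Lemma qdotNr x y : qdot x (- y) = - qdot x y.
Proof. by rewrite /qdot /=; ring. Qed.

Lemma qdot0r x : qdot x 0 = 0.
Proof. by rewrite /qdot /= !mulr0 !addr0. Qed.

Lemma qdotM x c : qdot (x * c) (x * c) = qdot x x * qdot c c.
Proof. by case: x c => a b c' d [? ? ? ?]; rewrite /qdot /=; ring. Qed.

(** Expand the nonnegative quantity [t * |x - y / t|^2]; the lower bound follows by replacing [y]
    with [- y]. The free weight [t] lets this do the work of Cauchy-Schwarz. *)
Lemma qdot_amgm t x y : 0 < t ->
  `|qdot x y| <= 2^-1 * (t * qdot x x + t^-1 * qdot y y).
Proof.
have H z : 0 < t -> qdot x z <= 2^-1 * (t * qdot x x + t^-1 * qdot z z).
  move=> t0; have : 0 <= t * qdot (x - qreal t^-1 * z) (x - qreal t^-1 * z).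
    by rewrite mulr_ge0 ?qdot_ge0 // ltW.
  have -> : t * qdot (x - qreal t^-1 * z) (x - qreal t^-1 * z) =
      t * qdot x x + t^-1 * qdot z z - 2 * qdot x z.
    by case: x z => ? ? ? ? [? ? ? ?]; rewrite /qdot /=; field; rewrite gt_eqF.
  lra.
move=> t0; rewrite ler_norml H // andbT.
by have := H (- y) t0; rewrite !qdotNr (qdotC (- y)) qdotNr opprK; lra.
Qed.

Lemma qdot_sum_le e x y : 0 < e ->
  qdot (x + y) (x + y) <= (1 + e) * qdot x x + (1 + e^-1) * qdot y y.
Proof.
move=> e0; have := qdot_amgm x y e0; rewrite ler_norml => /andP[_].
by rewrite !(qdotDr, qdotC (x + y)) (qdotC y x); lra.
Qed.

Definition nsq h : R := rsum (fun k => qdot (h k) (h k)).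

Lemma l2P h : l2 h <-> rsummable (fun k => qdot (h k) (h k)).
Proof.
rewrite /l2 /l2normsq /rsummable.
under eq_esum do rewrite qabs_sqr.
by under [in X in _ <-> X]eq_esum do rewrite ger0_norm ?qdot_ge0 //.
Qed.

Lemma l2normsqE h : l2 h -> l2normsq h = (nsq h)%:E.
Proof.
move=> /l2P sh; rewrite /l2normsq; under eq_esum do rewrite qabs_sqr.
by rewrite rsum_ge0 // => k; exact: qdot_ge0.
Qed.

Lemma nsq_ge0 h : l2 h -> 0 <= nsq h.
Proof.
move=> lh; rewrite -lee_fin -l2normsqE // esum_ge0 // => k _.
by rewrite lee_fin sqr_ge0.
Qed.

Lemma rsummable_qdot f h : l2 f -> l2 h -> rsummable (fun k => qdot (f k) (h k)).
Proof.
move=> /l2P sf /l2P sh.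
apply: (rsummable_le (fun k => qdot_amgm (f k) (h k) ltr01)).
by apply: rsummableZ; apply: rsummableD; apply: rsummableZ.
Qed.

Lemma rsum_qdot_le t f h : 0 < t -> l2 f -> l2 h ->
  `|rsum (fun k => qdot (f k) (h k))| <= 2^-1 * (t * nsq f + t^-1 * nsq h).
Proof.
move=> t0 /l2P sf /l2P sh.
have sf' := rsummableZ t sf; have sh' := rsummableZ t^-1 sh.
have sfh := rsummableD sf' sh'.
apply: le_trans (ler_norm_rsum (fun k => qdot_amgm (f k) (h k) t0) _) _.
  exact: rsummableZ.
by rewrite (rsumZ _ sfh) (rsumD sf' sh') (rsumZ _ sf) (rsumZ _ sh).
Qed.

(* The components of [qconj x * y] are real inner products with [y], after
   rotating [x] by a unit. *)
Lemma l2innerE f h : l2inner f h =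
  Quat (rsum (fun k => qdot (f k * 1) (h k)))
       (rsum (fun k => qdot (f k * qi) (h k)))
       (rsum (fun k => qdot (f k * qj) (h k)))
       (rsum (fun k => qdot (f k * (qi * qj)) (h k))).
Proof.
rewrite qi_qj; apply: quat_eq => /=; congr rsum; apply/funext => k;
  by case: (f k) (h k) => ? ? ? ? [? ? ? ?]; rewrite /qdot /=; ring.
Qed.

Lemma l2_rotate f c : qdot c c = 1 -> l2 f -> l2 (fun k => f k * c).
Proof.
move=> c1 /l2P sf; apply/l2P; under eq_fun do rewrite qdotM c1 mulr1.
exact: sf.
Qed.

Lemma nsq_rotate f c : qdot c c = 1 -> nsq (fun k => f k * c) = nsq f.
Proof. by move=> c1; rewrite /nsq; under eq_fun do rewrite qdotM c1 mulr1. Qed.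

Let q1 : qdot 1 1 = 1 :> R.
Proof. by rewrite /qdot /=; ring. Qed.
Let qi1 : qdot qi qi = 1 :> R.
Proof. by rewrite /qdot /=; ring. Qed.
Let qj1 : qdot qj qj = 1 :> R.
Proof. by rewrite /qdot /=; ring. Qed.
Let qij1 : qdot (qi * qj) (qi * qj) = 1 :> R.
Proof. by rewrite qi_qj /qdot /=; ring. Qed.

Lemma l2innerDr f h h' : l2 f -> l2 h -> l2 h' ->
  l2inner f (fun k => h k + h' k) = l2inner f h + l2inner f h'.
Proof.
move=> lf lh lh'; rewrite !l2innerE.
have D c : qdot c c = 1 -> rsum (fun k => qdot (f k * c) (h k + h' k)) =
    rsum (fun k => qdot (f k * c) (h k)) + rsum (fun k => qdot (f k * c) (h' k)).
  move=> c1; have lfc := l2_rotate c1 lf.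
  under eq_fun do rewrite qdotDr.
  by rewrite rsumD //; exact: rsummable_qdot.
by rewrite !D.
Qed.

(** Quantitative continuity of the inner product at zero: each of the four real components
    contributes at most a quarter of the bound. *)
Lemma l2inner_small f h (d : R) : l2 f -> l2 h -> 0 < d -> nsq h <= d ->
  qabs (l2inner f h) ^+ 2 <= (nsq f + 1) ^+ 2 * d.
Proof.
move=> lf lh d0 hd; rewrite l2innerE qabs_sqr.
(* With weight [sqrt d], both terms of [rsum_qdot_le] are of order [sqrt d]. *)
set t := Num.sqrt d; have t0 : 0 < t by rewrite sqrtr_gt0.
have tt : t ^+ 2 = d by rewrite sqr_sqrtr // ltW.
have B c : qdot c c = 1 ->
    rsum (fun k => qdot (f k * c) (h k)) ^+ 2 <= 4^-1 * ((nsq f + 1) ^+ 2 * d).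
  move=> c1; have T0 : 0 <= 2^-1 * (nsq f + 1) * t.
    apply: mulr_ge0 (ltW t0); rewrite mulr_ge0 ?invr_ge0 //.
    by rewrite addr_ge0 ?nsq_ge0.
  rewrite -(real_normK (num_real _)).
  rewrite [leRHS](_ : _ = (2^-1 * (nsq f + 1) * t) ^+ 2); last by rewrite -tt; field.
  rewrite ler_sqr ?nnegrE //.
  apply: le_trans (rsum_qdot_le t0 (l2_rotate c1 lf) lh) _.
  rewrite nsq_rotate // -mulrA ler_pM2l ?invr_gt0 // mulrDl mul1r mulrC lerD2l.
  by rewrite mulrC ler_pdivrMr // -expr2 tt.
have := B _ q1; have := B _ qi1; have := B _ qj1; have := B _ qij1.
rewrite [qdot (Quat _ _ _ _) _]/qdot /= -!expr2; lra.
Qed.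

(** * Finitely supported functions and approximation by them *)

Lemma l2_finsupp (s : seq Z2) h : uniq s -> (forall k, k \notin s -> h k = 0) -> l2 h.
Proof.
by move=> us hs; apply/l2P/(rsummable_finsupp us) => k /hs ->; rewrite qdot0r.
Qed.

Lemma nsq_finsupp (s : seq Z2) h : uniq s -> (forall k, k \notin s -> h k = 0) ->
  nsq h = \sum_(k <- s) qdot (h k) (h k).
Proof. by move=> us hs; apply: rsum_finsupp => // k /hs ->; rewrite qdot0r. Qed.

Lemma l2inner_finsupp (s : seq Z2) f h : uniq s ->
  (forall k, k \notin s -> h k = 0) ->
  l2inner f h = \sum_(k <- s) qconj (f k) * h k.
Proof.
move=> us hs; apply: quat_eq => /=.
- by rewrite qre_sum; apply: rsum_finsupp => // k /hs ->; rewrite mulr0.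
- by rewrite qim1_sum; apply: rsum_finsupp => // k /hs ->; rewrite mulr0.
- by rewrite qim2_sum; apply: rsum_finsupp => // k /hs ->; rewrite mulr0.
- by rewrite qim3_sum; apply: rsum_finsupp => // k /hs ->; rewrite mulr0.
Qed.

Lemma l2_approx h (d : R) : l2 h -> 0 < d -> exists s : seq Z2,
  let hd k := if k \in s then h k else 0 in
  let tl k := if k \in s then 0 else h k in
  [/\ uniq s, l2 hd, l2 tl, nsq tl <= d & nsq h = nsq hd + nsq tl].
Proof.
move=> /l2P sh d0.
have [s us le_d] := esum_tail sh (fun k => qdot_ge0 (h k)) d0.
exists s => hd tl.
have lhd : l2 hd by apply: l2_finsupp us _ => k /negbTE; rewrite /hd => ->.
have tlE k : qdot (tl k) (tl k) = if k \in s then 0 else qdot (h k) (h k).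
  by rewrite /tl; case: ifP; rewrite ?qdot0r.
have ltl : l2 tl.
  apply/l2P; apply: rsummable_le sh => k.
  by rewrite tlE; case: ifP; rewrite ?normr0 ?ger0_norm ?qdot_ge0.
split => //.
  rewrite -lee_fin -l2normsqE // /l2normsq; apply: le_trans le_d.
  by apply: le_esum => k _; rewrite qabs_sqr tlE.
rewrite /nsq -(rsumD ((l2P hd).1 lhd) ((l2P tl).1 ltl)).
congr rsum; apply/funext => k; rewrite /hd /tl.
by case: ifP; rewrite qdot0r ?addr0 ?add0r.
Qed.

Lemma ler_of_approx (X Y C : R) : 0 <= Y -> 0 <= C ->
  (forall e d, 0 < e -> 0 < d -> X <= (1 + e) * Y + (1 + e^-1) * (C * d)) ->
  X <= Y.
Proof.
move=> Y0 C0 H; apply/ler_addgt0Pr => r r0.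
(* First [e] makes [e * Y] at most [r / 2]; then [d], depending on [e], absorbs the factor
   [1 + e^-1]. Adding 1 to [Y] and [C] keeps the denominators positive. *)
pose e := r / (2 * (Y + 1)); pose d := r / (2 * (1 + e^-1) * (C + 1)).
have C1 : 0 < C + 1 by rewrite ltr_wpDl.
have Y1 : 0 < Y + 1 by rewrite ltr_wpDl.
have e0 : 0 < e by rewrite divr_gt0 // mulr_gt0.
have ei : 0 < 1 + e^-1 by rewrite addr_gt0 // invr_gt0.
have D0 : 0 < 2 * (1 + e^-1) * (C + 1) by apply: mulr_gt0 => //; apply: mulr_gt0.
have d0 : 0 < d by rewrite divr_gt0.
apply: le_trans (H e d e0 d0) _.
have H1 : e * Y <= r / 2.
  rewrite /e mulrAC ler_pdivrMr; last by rewrite mulr_gt0.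
  by rewrite mulrA divfK // ler_pM2l // lerDl.
have H2 : (1 + e^-1) * (C * d) <= r / 2.
  rewrite /d !mulrA ler_pdivrMr; last by [].
  rewrite [leRHS](_ : _ = (1 + e^-1) * (C + 1) * r); last by field; rewrite gt_eqF.
  by rewrite ler_pM2r // ler_pM2l // lerDl.
rewrite mulrDl mul1r; lra.
Qed.

(* Bessel's inequality passes from finitely supported functions to all of l2 by
   bounding finite partial sums; equality then follows by applying Bessel to
   the tail of [h]. *)
Lemma parseval_of_finsupp (I : choiceType) (q : I -> (Z2 -> quat R) -> R)
    (C : I -> R) :
  (forall i h, 0 <= q i h) ->
  (forall i h h' e, l2 h -> l2 h' -> 0 < e ->
     q i (fun k => h k + h' k) <= (1 + e) * q i h + (1 + e^-1) * q i h') ->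
  (forall i h d, l2 h -> 0 < d -> nsq h <= d -> q i h <= C i * d) ->
  (forall s h, uniq s -> (forall k, k \notin s -> h k = 0) ->
     (\esum_(i in [set: I]) (q i h)%:E = l2normsq h)%E) ->
  forall h, l2 h -> (\esum_(i in [set: I]) (q i h)%:E = l2normsq h)%E.
Proof.
move=> q0 qD qC qfin.
(* The zero function has squared norm at most [d = 1], so [C i] bounds a nonnegative value. *)
have C0 i : 0 <= C i.
  have l0 : l2 (fun _ => 0 : quat R) by apply: (@l2_finsupp [::]).
  have n0 : nsq (fun _ => 0) <= 1.
    by rewrite (@nsq_finsupp [::]) // big_nil ler01.
  by have := qC i _ 1 l0 ltr01 n0; rewrite mulr1; apply: le_trans; exact: q0.
have split_h (s : seq Z2) h :
    h = (fun k => (if k \in s then h k else 0) + (if k \in s then 0 else h k)).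
  by apply/funext => k; case: ifP; rewrite ?addr0 ?add0r.
have bessel h : l2 h -> (\esum_(i in [set: I]) (q i h)%:E <= l2normsq h)%E.
  move=> lh; rewrite l2normsqE //; apply: ge_ereal_sup => _ [A [finA _] <-].
  rewrite fsbig_finite //= sumEFin lee_fin.
  (* The constants [C i] need not be summable over all of [I], so the tail estimate is applied to a
     finite index set [A] only. *)
  apply: (@ler_of_approx _ _ (\sum_(i <- finmap.enum_fset (fset_set A)) C i)).
  - exact: nsq_ge0.
  - by apply: sumr_ge0.
  move=> e d e0 d0; have [s [us lhd ltl tl_d hE]] := l2_approx lh d0.
  set hd := (fun k => if k \in s then h k else 0) in lhd hE.
  set tl := (fun k => if k \in s then 0 else h k) in ltl tl_d hE.
  have S i : q i h <= (1 + e) * q i hd + (1 + e^-1) * (C i * d).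
    rewrite (split_h s h); apply: le_trans (qD i hd tl e lhd ltl e0) _.
    rewrite lerD2l ler_wpM2l ?addr_ge0 ?invr_ge0 ?(ltW e0) //; exact: qC.
  apply: le_trans (ler_sum _ (fun i _ => S i)) _.
  rewrite big_split /= -!mulr_sumr -mulr_suml lerD2r ler_wpM2l //.
    by rewrite addr_ge0 // ltW.
  apply: (@le_trans _ _ (nsq hd)); last by rewrite hE lerDl nsq_ge0.
  rewrite -lee_fin -l2normsqE // -(qfin s hd us); last first.
    by move=> k /negbTE; rewrite /hd => ->.
  apply: esum_ge; exists A; first by split.
  by rewrite fsbig_finite //= sumEFin.
move=> h lh; have qs (f : Z2 -> quat R) : l2 f -> rsummable (fun i => q i f).
  move=> lf; apply: le_lt_trans (lf); apply: le_trans (bessel f lf).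
  by under eq_esum do rewrite ger0_norm //.
have qE : forall f : Z2 -> quat R, l2 f ->
    (\esum_(i in [set: I]) (q i f)%:E = (rsum (fun i => q i f))%:E)%E.
  by move=> f lf; rewrite rsum_ge0 //; exact: qs.
have bessel' (f : Z2 -> quat R) : l2 f -> rsum (fun i => q i f) <= nsq f.
  by move=> lf; rewrite -lee_fin -qE // -l2normsqE //; exact: bessel.
apply/eqP; rewrite eq_le bessel //= qE // l2normsqE // lee_fin.
have r0 : 0 <= rsum (fun i => q i h).
  by rewrite -lee_fin -qE // esum_ge0 // => i _; rewrite lee_fin.
(* The constant 2 counts two errors, each at most [(1 + e^-1) * d]: the norm of the tail missing
   from the head, and the energy of the tail, bounded by Bessel. *)
apply: (@ler_of_approx _ _ 2) => // e d e0 d0.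
have [s [us lhd ltl tl_d hE]] := l2_approx lh d0.
set hd := (fun k => if k \in s then h k else 0) in lhd hE.
set tl := (fun k => if k \in s then 0 else h k) in ltl tl_d hE.
have ltlN : l2 (fun k => - tl k).
  move/l2P: ltl => ltl; apply/l2P.
  by under eq_fun do rewrite qdotNr qdotC qdotNr opprK.
have nN : nsq (fun k => - tl k) = nsq tl.
  by rewrite /nsq; under eq_fun do rewrite qdotNr qdotC qdotNr opprK.
have ei : 0 < e^-1 by rewrite invr_gt0.
have hdq : nsq hd = rsum (fun i => q i hd).
  apply/EFin_inj; rewrite -l2normsqE // -qE // (qfin s) //.
  by move=> k /negbTE; rewrite /hd => ->.
(* The head is [h] plus the negated tail, so quasi-subadditivity bounds its energy from the energy
   of [h]. *)
have : rsum (fun i => q i hd) <= (1 + e) * rsum (fun i => q i h)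
    + (1 + e^-1) * rsum (fun i => q i (fun k => - tl k)).
  have sh := qs h lh; have st := qs _ ltlN.
  rewrite -!rsumZ // -rsumD; [|exact: rsummableZ..].
  apply: le_trans (ler_norm _) _; apply: ler_norm_rsum => [i|]; last first.
    by apply: rsummableD; apply: rsummableZ.
  rewrite ger0_norm //; apply: le_trans (qD i h (fun k => - tl k) e lh ltlN e0).
  rewrite le_eqVlt; apply/orP; left; apply/eqP; congr q; apply/funext => k.
  by rewrite /hd /tl; case: ifP; rewrite ?oppr0 ?addr0 ?subrr.
have := bessel' _ ltlN; rewrite nN hE hdq => b.
move=> H; rewrite mulrCA.
have : (1 + e^-1) * rsum (fun i => q i (fun k => - tl k)) <= (1 + e^-1) * d.
  by rewrite ler_pM2l ?addr_gt0 //; apply: le_trans tl_d.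
have : d <= (1 + e^-1) * d by rewrite mulrDl mul1r lerDl mulr_ge0 // ltW.
lra.
Qed.

End SquareSummable.

(** * Gabor systems *)

Lemma Z2_mulrn (x : Z2) n : x *+ n = (x.1 *+ n, x.2 *+ n).
Proof.
by elim: n => [|n IH]; rewrite ?mulr0n // !mulrS IH.
Qed.

Lemma Z2_mulrn_inj n : (0 < n)%N -> injective (fun x : Z2 => x *+ n).
Proof.
move=> n0 [a b] [c d]; rewrite !Z2_mulrn /= => -[].
by move=> /(pmulrnI n0) -> /(pmulrnI n0) ->.
Qed.

Lemma Z2_add (a b c d : int) : (a, b) + (c, d) = (a + c, b + d) :> Z2.
Proof. by []. Qed.

Lemma eqmodZ2P (M : nat) (k k' : Z2) :
  reflect (exists p, k' = k + p *+ M) (eqmodZ2 M k k').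
Proof.
case: k k' => [k1 k2] [k1' k2']; rewrite /eqmodZ2 /=.
apply: (iffP andP) => [[/dvdzP[a Ha] /dvdzP[b Hb]]|[[a b]]].
  exists (- a, - b); rewrite Z2_mulrn Z2_add /= !mulNrn.
  rewrite -(mulr_natr a) -(mulr_natr b) !natz -Ha -Hb.
  by rewrite !opprB !addrA ![_ + k1' - _]addrAC ![_ + k2' - _]addrAC !subrr !add0r.
rewrite Z2_mulrn Z2_add /= => -[-> ->].
rewrite !opprD !addrA !subrr !sub0r.
by rewrite -(mulr_natr a) -(mulr_natr b) !natz -!mulNr !dvdz_mull.
Qed.

Lemma Z2_divn (N : nat) (k : Z2) : (0 < N)%N ->
  exists (r : 'I_N * 'I_N) (j : Z2),
    k = ((r.1 : nat)%:Z, (r.2 : nat)%:Z) + j *+ N.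
Proof.
move=> N0; have H (z : int) : exists (r : 'I_N) (q : int), z = r%:Z + q *+ N.
  have r0 : 0 <= (z %% N)%Z by rewrite modz_ge0 // eqz_nat -lt0n.
  have rN : (`|(z %% N)%Z|%N < N)%N.
    by rewrite -ltz_nat gez0_abs // ltz_pmod.
  exists (Ordinal rN), (z %/ N)%Z; rewrite /= gez0_abs // -mulr_natr natz addrC.
  exact: divz_eq.
have [r1 [q1 E1]] := H k.1; have [r2 [q2 E2]] := H k.2.
exists (r1, r2), (q1, q2); rewrite Z2_mulrn /=.
by case: k E1 E2 => k1 k2 /= -> ->.
Qed.

(** * Energy and autocorrelation of a Gabor system with real windows *)

Section GaborFrames.
Variables (R : realType) (L M N : nat).
Hypotheses (M0 : (0 < M)%N) (N0 : (0 < N)%N).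
Variable g : 'I_L -> Z2 -> quat R.
Variable gam : 'I_L -> Z2 -> R.
Hypothesis gE : forall l k, g l k = qreal (gam l k).
Hypothesis gl2 : forall l, l2 (g l).
Implicit Types (k n p : Z2) (h : Z2 -> quat R) (l : 'I_L) (m : 'I_M * 'I_M).

(** The kernel [G] of the overview; for [k' = k + p *+ M] it is the matrix entry of condition 2, by
    [gram_entryE]. *)
Definition autocorr k k' : R :=
  \sum_(l < L) rsum (fun n => gam l (k - n *+ N) * gam l (k' - n *+ N)).

Lemma translate_inj k : injective (fun n : Z2 => k - n *+ N).
Proof. by move=> a b /addrI /oppr_inj /(Z2_mulrn_inj N0). Qed.

Lemma rsummable_gam l : rsummable (fun k => gam l k ^+ 2).
Proof.
have /l2P := gl2 l; under eq_fun do
  rewrite gE /qdot /= !mulr0 !addr0 -expr2.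
by [].
Qed.

(** Products are dominated by sums of squares, and since [n] maps injectively to [k - n *+ N], these
    are subsums of the squared norm of [g l]. *)
Lemma rsummable_autocorr l k k' :
  rsummable (fun n => gam l (k - n *+ N) * gam l (k' - n *+ N)).
Proof.
have S a := rsummable_inj (@translate_inj a) (rsummable_gam l).
apply: (@rsummable_le _ _ _
  (fun n => gam l (k - n *+ N) ^+ 2 + gam l (k' - n *+ N) ^+ 2)).
  move=> n; set a := gam l _; set b := gam l _.
  have := sqr_ge0 (a - b); have := sqr_ge0 (a + b).
  by rewrite ler_norml; move: (sqr_ge0 a) (sqr_ge0 b); nra.
exact: rsummableD (S k) (S k').
Qed.

(** Reindexing the translations by [n + j] absorbs the shift. This is why condition 2 only has to
    range over residues modulo [N]. *)
Lemma autocorr_shift k k' j : autocorr (k + j *+ N) (k' + j *+ N) = autocorr k k'.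
Proof.
apply: eq_bigr => l _; rewrite (@rsum_reindex _ _ _ (fun n => n + j)).
  congr rsum; apply/funext => n; congr (gam l _ * gam l _);
    by rewrite mulrnDl opprD addrACA subrr addr0.
by exists (fun n => n - j) => n; rewrite ?addrK ?subrK.
Qed.

Lemma gabor_systemE l m n k :
  gabor_system N g l m n k = gabor_char R m k * qreal (gam l (k - n *+ N)).
Proof.
by rewrite /gabor_system /modulation /translation gE -!mulrA qreal_comm.
Qed.

Lemma qdot_gabor_system l m n k :
  qdot (gabor_system N g l m n k) (gabor_system N g l m n k) =
  gam l (k - n *+ N) ^+ 2.
Proof.
rewrite gabor_systemE qdotM /gabor_char qdotM qexp_i qexp_j /qdot /=.
by rewrite !mulr0 !addr0 -!expr2 !cos2Dsin2 !mul1r.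
Qed.

Lemma l2_gabor_system l m n : l2 (gabor_system N g l m n).
Proof.
apply/l2P; under eq_fun do rewrite qdot_gabor_system.
by apply: (rsummable_inj _ (rsummable_gam l)) => a b /addIr.
Qed.

(** Grouping the finite sums over [l] and [m] makes the frame sum a single sum over [n], the shape
    required by [parseval_of_finsupp]. *)
Definition gabor_energy n h : R :=
  \sum_(l < L) \sum_(m : 'I_M * 'I_M)
    qabs (l2inner (gabor_system N g l m n) h) ^+ 2.

Lemma parseval_gabor_frameE : parseval_gabor_frame M N g <->
  (forall h, l2 h -> \esum_(n in [set: Z2]) (gabor_energy n h)%:E = l2normsq h)%E.
Proof.
have E h : (\sum_(l < L) \esum_(n in [set: Z2]) \sum_(m : 'I_M * 'I_M)
    (qabs (l2inner (gabor_system N g l m n) h) ^+ 2)%:E =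
    \esum_(n in [set: Z2]) (gabor_energy n h)%:E)%E.
  rewrite -esum_sum; last first.
    by move=> n l _ _; apply: sume_ge0 => m _; rewrite lee_fin sqr_ge0.
  by apply: eq_esum => n _; under eq_bigr do rewrite sumEFin; rewrite sumEFin.
by split=> H h lh; [rewrite -E | rewrite E]; exact: H.
Qed.

Lemma gabor_energy_finsupp (s : seq Z2) h : uniq s ->
  (forall k, k \notin s -> h k = 0) ->
  (\esum_(n in [set: Z2]) (gabor_energy n h)%:E =
   (\sum_(k <- s) \sum_(k' <- s)
     (if eqmodZ2 M k k' then M%:R ^+ 2 else 0) * qdot (h k) (h k')
     * autocorr k k')%R%:E)%E.
Proof.
move=> us hs.
pose c k k' : R := (if eqmodZ2 M k k' then M%:R ^+ 2 else 0) * qdot (h k) (h k').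
have E n : gabor_energy n h = \sum_(k <- s) \sum_(k' <- s) \sum_(l < L)
    c k k' * (gam l (k - n *+ N) * gam l (k' - n *+ N)).
  under eq_bigr => k _ do rewrite exchange_big.
  rewrite exchange_big /=; apply: eq_bigr => l _.
  under [LHS]eq_bigr => m _.
    rewrite (l2inner_finsupp _ us hs); under eq_bigr => k _.
      rewrite gabor_systemE qconjM.
      rewrite (_ : qconj (qreal _) = qreal (gam l (k - n *+ N))); last first.
        by apply: quat_eq; rewrite //= oppr0.
      rewrite qreal_comm -mulrA.
      over.
    over.
  rewrite (gabor_char_plancherel s (fun k => qreal (gam l (k - n *+ N)) * h k)) //.
  apply: eq_bigr => k _; apply: eq_bigr => k' _.
  by rewrite qdot_realM /c; ring.
have S k k' l : rsummable (fun n =>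
    c k k' * (gam l (k - n *+ N) * gam l (k' - n *+ N))).
  exact/rsummableZ/rsummable_autocorr.
under eq_esum do rewrite E.
(* Summability is read off the expansion [E], nonnegativity off the original sum of squares. *)
rewrite rsum_ge0; last 2 first.
- by do 3 (apply: rsummable_sum => ?); exact: S.
- move=> n; rewrite -E; apply: sumr_ge0 => l _; apply: sumr_ge0 => m _.
  exact: sqr_ge0.
congr (_%:E); rewrite rsum_sum; last first.
  by move=> k; do 2 (apply: rsummable_sum => ?); exact: S.
apply: eq_bigr => k _; rewrite rsum_sum; last first.
  by move=> k'; apply: rsummable_sum => ?; exact: S.
apply: eq_bigr => k' _; rewrite rsum_sum; last by move=> l; exact: S.
rewrite mulr_sumr; apply: eq_bigr => l _; rewrite rsumZ //.
exact: rsummable_autocorr.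
Qed.

Lemma autocorr_parseval :
  (forall k k', eqmodZ2 M k k' ->
     autocorr k k' = if k == k' then (M%:R ^+ 2)^-1 else 0) ->
  parseval_gabor_frame M N g.
Proof.
move=> H; apply/parseval_gabor_frameE.
have Mn : M%:R != 0 :> R by rewrite pnatr_eq0 -lt0n.
apply: (@parseval_of_finsupp _ _ _
  (fun n => \sum_(l < L) \sum_(m : 'I_M * 'I_M)
     (nsq (gabor_system N g l m n) + 1) ^+ 2)).
- by move=> n h; apply: sumr_ge0 => l _; apply: sumr_ge0 => m _; exact: sqr_ge0.
- move=> n h h' e lh lh' e0; rewrite !mulr_sumr -big_split /=.
  apply: ler_sum => l _; rewrite !mulr_sumr -big_split /=.
  apply: ler_sum => m _; rewrite !qabs_sqr l2innerDr //; last exact: l2_gabor_system.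
  exact: qdot_sum_le.
- move=> n h d lh d0 hd; rewrite mulr_suml; apply: ler_sum => l _.
  rewrite mulr_suml; apply: ler_sum => m _.
  by apply: l2inner_small => //; exact: l2_gabor_system.
move=> s h us hs; rewrite (gabor_energy_finsupp us hs).
rewrite l2normsqE; last exact: l2_finsupp us hs.
rewrite (nsq_finsupp us hs); congr (_%:E); rewrite big_seq [RHS]big_seq.
(* Only [k' = k] survives: incongruent pairs have weight zero, and distinct congruent ones have zero
   autocorrelation. *)
apply: eq_bigr => k ks; rewrite (bigD1_seq k) //= big1 ?addr0 => [|k' kk'].
  have kk : eqmodZ2 M k k by apply/eqmodZ2P; exists 0; rewrite mul0rn addr0.
  by rewrite kk H // eqxx mulrAC mulfV ?mul1r // expf_neq0.
case: ifP => [E|_]; last by rewrite !mul0r.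
by rewrite H // eq_sym (negbTE kk') mulr0.
Qed.

Lemma parseval_autocorr : parseval_gabor_frame M N g ->
  forall k k', eqmodZ2 M k k' ->
    autocorr k k' = if k == k' then (M%:R ^+ 2)^-1 else 0.
Proof.
move=> /parseval_gabor_frameE P.
have Mn : M%:R ^+ 2 != 0 :> R by rewrite expf_neq0 // pnatr_eq0 -lt0n.
have F (s : seq Z2) h : uniq s -> (forall k, k \notin s -> h k = 0) ->
    \sum_(k <- s) \sum_(k' <- s)
     (if eqmodZ2 M k k' then M%:R ^+ 2 else 0) * qdot (h k) (h k') * autocorr k k'
    = \sum_(k <- s) qdot (h k) (h k).
  move=> us hs; have lh := l2_finsupp us hs; apply: EFin_inj.
  by rewrite -(gabor_energy_finsupp us hs) P // l2normsqE // (nsq_finsupp us hs).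
have refl k : eqmodZ2 M k k by apply/eqmodZ2P; exists 0; rewrite mul0rn addr0.
have q1 : qdot 1 1 = 1 :> R by rewrite /qdot /=; ring.
(* Test on the unit mass at [k]. *)
have diag k : M%:R ^+ 2 * autocorr k k = 1.
  have := F [:: k] (fun j => if j \in [:: k] then 1 else 0) isT.
  rewrite !big_seq1 refl inE eqxx q1 mulr1; apply=> j /negbTE.
  by rewrite inE => ->.
have sym k k' : autocorr k' k = autocorr k k'.
  by apply: eq_bigr => l _; congr rsum; apply/funext => n; rewrite mulrC.
move=> k k' kk'; case: eqP => [<-|/eqP nk].
  by apply: (mulfI Mn); rewrite diag mulfV.
have k'k : eqmodZ2 M k' k.
  by move: kk' => /eqmodZ2P[p ->]; apply/eqmodZ2P; exists (- p); rewrite mulNrn addrK.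
(* Test on two unit masses: the diagonal terms already account for the squared norm 2, so the two
   equal cross terms vanish. *)
have := F [:: k; k'] (fun j => if j \in [:: k; k'] then 1 else 0).
rewrite /= !inE nk !big_cons !big_nil !inE !eqxx ?orbT !refl kk' k'k /= q1 !mulr1.
rewrite !addr0 (sym k k') (diag k) (diag k') => /(_ isT) H.
apply: (mulfI Mn); rewrite mulr0.
have : 1 + M%:R ^+ 2 * autocorr k k' + (M%:R ^+ 2 * autocorr k k' + 1) = 1 + 1.
  by apply: H => j /negbTE; rewrite !inE => ->.
lra.
Qed.

Lemma gram_entryE (k p : Z2) :
  (\sum_(l < L) imx_mul (gabor_mx M N (g l) k) (imx_tr (gabor_mx M N (g l) k)))
    (0 : Z2) p = qreal (autocorr k (k + p *+ M)).
Proof.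
rewrite !fct_sumE qreal_sum; apply: eq_bigr => l _.
rewrite /imx_mul /imx_tr /gabor_mx mul0rn addr0.
under eq_fun do rewrite !gE -qrealM.
by congr Quat; rewrite (@rsum_finsupp _ _ [::]) ?big_nil.
Qed.

End GaborFrames.

Theorem theorem3 (R : realType) (L M N : nat)
  (hL : (0 < L)%N) (hM : (0 < M)%N) (hN : (0 < N)%N)
  (g : 'I_L -> Z2 -> quat R) (hg : forall l : 'I_L, l2real (g l)) :
  parseval_gabor_frame M N g <->
  (forall (k : 'I_N * 'I_N) (p : Z2),
     (\sum_(l < L)
        imx_mul (gabor_mx M N (g l) ((k.1 : nat)%:Z, (k.2 : nat)%:Z))
                (imx_tr (gabor_mx M N (g l) ((k.1 : nat)%:Z, (k.2 : nat)%:Z))))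
       (0 : Z2) p
     = qreal (1 / M%:R ^+ 2 * \1_[set (0 : Z2)] p)).
Proof.
pose gam l k := qre (g l k).
have gE l k : g l k = qreal (gam l k).
  by have [_ /(_ k)[r gk]] := hg l; rewrite /gam gk.
have gl2 l : l2 (g l) by have [] := hg l.
(* As [M] is positive, [p = 0] amounts to [k = k + p *+ M], which turns the indicator into the
   diagonal condition on [autocorr]. *)
have rhs (k p : Z2) : 1 / M%:R ^+ 2 * \1_[set (0 : Z2)] p =
    (if k == k + p *+ M then (M%:R ^+ 2)^-1 else 0 : R).
  rewrite div1r indicE; case: (eqVneq k (k + p *+ M)) => [kp|nk].
    rewrite mem_set ?mulr1 //=; apply: (Z2_mulrn_inj hM); apply: (addrI k).
    by rewrite mul0rn addr0.
  rewrite memNset /= ?mulr0 // => p0.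
  by rewrite p0 mul0rn addr0 eqxx in nk.
split=> [P k p|H].
  rewrite (gram_entryE M N gE) (rhs ((k.1 : nat)%:Z, (k.2 : nat)%:Z)).
  congr qreal; apply: (parseval_autocorr hM hN gE gl2 P).
  by apply/eqmodZ2P; exists p.
apply: (autocorr_parseval hM hN gE gl2) => k k' /eqmodZ2P[p ->].
(* Write [k] as a residue plus a multiple of [N]; shift invariance then reduces the claim to
   condition 2 at that residue. *)
have [r [j ->]] := Z2_divn k hN.
rewrite -rhs addrAC autocorr_shift.
have := H r p; rewrite (gram_entryE M N gE) => /(congr1 (@qre R)); exact.
Qed.
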